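(* Let $T$ be an operator semigroup on a set $D$, let $S$ be a $T$-space and let $B\subseteq S$. Let $\mathcal{T}_4$ be the topology on $\operatorname{Aut}_T(S)$ generated by the subbasis $\{\operatorname{Aut}_T(S)\setminus H: H\in\operatorname{GSGr}_T(S/B)\}\cup\{\operatorname{Aut}_T(S)\}$. Let $P_4$ be the set of all topologies on $\operatorname{Aut}_T(S)$ for which $$\operatorname{GSGr}_T(S/B)=\{M\in\operatorname{SGr}(\operatorname{GGr}_T(S/B)): M\text{ is closed}\},\qquad ( * )$$ and let $Q_4$ be the set of all topologies on $\operatorname{Aut}_T(S)$ which are finer than (i.e. contain) $\mathcal{T}_4$. Then $P_4\subseteq Q_4$ and the following statements are equivalent: (i) $P_4\neq\emptyset$. (ii) For any intersection $G$ of finite unions of elements of $\operatorname{GSGr}_T(S/B)$, $G\in\operatorname{SGr}(\operatorname{Aut}_T(S))$ implies $G\in\operatorname{GSGr}_T(S/B)$. (iii) $\mathcal{T}_4\in P_4$ (where $P_4\subseteq Q_4$); that is, $\mathcal{T}_4$ is the coarsest topology on $\operatorname{Aut}_T(S)$ such that $( * )$ is satisfied. Moreover, if $\operatorname{GSGr}_T(S/B)$ is a complete $\vee$-sublattice of the complete lattice $\operatorname{SGr}(\operatorname{Aut}_T(S))$, then statements (i), (ii) and (iii) are true.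
   Context: An operator semigroup on a set $D$ is a (possibly empty) set $T$ of functions $D\to D$ closed under composition. For $U\subseteq D$ put $\langle U\rangle_T=\{f(u): f\in T,\ u\in U\}$; a $T$-space is a subset of $D$ of the form $\langle U\rangle_T$. A $T$-morphism from a $T$-space $S$ to a $T$-space is a map $\sigma$ with $\sigma(f(a))=f(\sigma(a))$ for all $a\in S$, $f\in T$; $\operatorname{Aut}_T(S)$ is the set of bijective $T$-morphisms from $S$ to itself, a group under composition. For $K\subseteq S$, $\operatorname{GGr}_T(S/K)=\{\sigma\in\operatorname{Aut}_T(S):\sigma(b)=b\ \forall b\in K\}$, a subgroup of $\operatorname{Aut}_T(S)$; $\operatorname{GSGr}_T(S/B)=\{\operatorname{GGr}_T(S/K): B\subseteq K\subseteq S\}$. $\operatorname{SGr}(G)$ denotes the set of all subgroups of a group $G$. $\operatorname{SGr}(\operatorname{Aut}_T(S))$ is a complete lattice under inclusion, the meet of a family being its intersection and the join of a family being the subgroup of $\operatorname{Aut}_T(S)$ generated by its union. A complete $\vee$-sublattice is a subset closed under arbitrary joins of the ambient lattice. Intersections in (ii) are over nonempty families. The topology generated by a subbasis is the collection of all unions of finite intersections of its members. *)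

(* Defs.v *)
From HB Require Import structures.
From mathcomp Require Import all_boot.
From mathcomp Require Import boolp classical_sets cardinality filter.

Set Implicit Arguments.
Unset Strict Implicit.
Unset Printing Implicit Defensive.

Local Open Scope classical_set_scope.

Record op_semigroup (D : Type) := OpSemigroup {
  op_set : set (D -> D);
  op_comp : forall f g, op_set f -> op_set g -> op_set (f \o g) }.

Definition gen_space (D : Type) (T : op_semigroup D) (U : set D) : set D :=
  [set x | exists f u, [/\ op_set T f, U u & x = f u]].

Record tspace (D : Type) (T : op_semigroup D) := TSpace {
  tcarrier :> set D;
  tcarrierP : exists U, tcarrier = gen_space T U }.

Lemma tspace_stable (D : Type) (T : op_semigroup D) (S : tspace T) f a :
  op_set T f -> tcarrier S a -> tcarrier S (f a).
Proof.
move=> Tf; have [U ->] := tcarrierP S; move=> [g [u [Tg Uu ->]]].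
by exists (f \o g), u; split => //; exact: op_comp.
Qed.

(* Elements of S form the type [set_type S]; T acts on it by restriction. *)
Definition tact (D : Type) (T : op_semigroup D) (S : tspace T)
    (f : D -> D) (Tf : op_set T f) (a : set_type S) : set_type S :=
  SigSub (mem_set (tspace_stable Tf (set_mem (valP a)))).

Definition tmorphism (D : Type) (T : op_semigroup D) (S S' : tspace T)
    (s : set_type S -> set_type S') : Prop :=
  forall (f : D -> D) (Tf : op_set T f) (a : set_type S), s (tact Tf a) = tact Tf (s a).

Record taut (D : Type) (T : op_semigroup D) (S : tspace T) := TAut {
  taut_fun :> set_type S -> set_type S;
  taut_bij : bijective taut_fun;
  taut_mor : tmorphism taut_fun }.

Section TAutGroup.
Variables (D : Type) (T : op_semigroup D) (S : tspace T).
Implicit Types s t : taut S.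

Lemma taut_eqP s t : s =1 t -> s = t.
Proof.
case: s t => [s bs ms] [t bt mt] /= /funext st.
by subst t; rewrite (Prop_irrelevance bs bt) (Prop_irrelevance ms mt).
Qed.

HB.instance Definition _ := gen_eqMixin (taut S).
HB.instance Definition _ := gen_choiceMixin (taut S).

Lemma taut_one_mor : tmorphism (@id (set_type S)).
Proof. by []. Qed.

Definition taut_one : taut S := TAut (Bijective (fun=> erefl) (fun=> erefl)) taut_one_mor.

Lemma taut_mul_mor s t : tmorphism (s \o t).
Proof. by move=> f Tf a /=; rewrite !taut_mor. Qed.

Definition taut_mul s t : taut S :=
  TAut (bij_comp (taut_bij s) (taut_bij t)) (@taut_mul_mor s t).

Lemma taut_inv_ex s : exists t : taut S, cancel s t /\ cancel t s.
Proof.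
have [g sK gK] := taut_bij s.
have mg : tmorphism g.
  by move=> f Tf a; apply: (can_inj sK); rewrite gK taut_mor gK.
by exists (TAut (Bijective gK sK) mg).
Qed.

Definition taut_inv s : taut S := projT1 (cid (taut_inv_ex s)).

Lemma taut_invK s : cancel s (taut_inv s) /\ cancel (taut_inv s) s.
Proof. exact: (projT2 (cid (taut_inv_ex s))). Qed.

Lemma taut_mulA : associative taut_mul.
Proof. by move=> s t u; exact: taut_eqP. Qed.

Lemma taut_mul1 : left_id taut_one taut_mul.
Proof. by move=> s; exact: taut_eqP. Qed.

Lemma taut_mulr1 : right_id taut_one taut_mul.
Proof. by move=> s; exact: taut_eqP. Qed.

Lemma taut_mulV : left_inverse taut_one taut_inv taut_mul.
Proof. by move=> s; apply: taut_eqP => a /=; exact: (taut_invK s).1. Qed.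

Lemma taut_mulrV : right_inverse taut_one taut_inv taut_mul.
Proof. by move=> s; apply: taut_eqP => a /=; exact: (taut_invK s).2. Qed.

HB.instance Definition _ := isGroup.Build (taut S)
  taut_mulA taut_mul1 taut_mulr1 taut_mulV taut_mulrV.

End TAutGroup.

(* [group_closed] asks for the unit and closure under division. *)
Definition SGr (G : groupType) : set (set G) :=
  [set M | group_closed [in M]].

Definition GGr (D : Type) (T : op_semigroup D) (S : tspace T) (K : set D) :
    set (taut S) :=
  [set s | forall b : set_type S, K (val b) -> s b = b].

Arguments GGr {D T} S K.

Definition GSGr (D : Type) (T : op_semigroup D) (S : tspace T) (B : set D) :
    set (set (taut S)) :=
  [set GGr S K | K in [set K : set D | B `<=` K /\ K `<=` S]].

Arguments GSGr {D T} S B.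

Arguments SGr : clear implicits.

Definition complete_join_sublattice (G : groupType) (L : set (set G)) : Prop :=
  L `<=` SGr G /\
  forall F : set (set G), F `<=` L -> L (smallest (SGr G) (\bigcup_(H in F) H)).

(* A topology is given by its collection of open sets. The empty set is open
   as the union of the empty family. *)
Definition is_topology (X : Type) (O : set (set X)) : Prop :=
  [/\ O setT,
      forall A A', O A -> O A' -> O (A `&` A') &
      forall F : set (set X), F `<=` O -> O (\bigcup_(A in F) A)].

Definition topology_generated (X : Type) (P : set (set X)) : set (set X) :=
  [set \bigcup_(A in F) A | F in [set F | F `<=` finI_from P id]].

Definition closed_in (X : Type) (O : set (set X)) (M : set X) : Prop := O (~` M).

Definition top4 (D : Type) (T : op_semigroup D) (S : tspace T) (B : set D) :
    set (set (taut S)) :=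
  topology_generated ([set ~` H | H in GSGr S B] `|` [set setT]).

Arguments top4 {D T} S B.

(* Subgroups of [GGr S B] are the subgroups of [taut S] it contains; closedness
   refers to the topology of the whole of [taut S]. *)
Definition P4 (D : Type) (T : op_semigroup D) (S : tspace T) (B : set D) :
    set (set (set (taut S))) :=
  [set O | is_topology O /\
    GSGr S B = [set M | [/\ SGr (taut S) M, M `<=` GGr S B & closed_in O M]]].

Arguments P4 {D T} S B.

Definition Q4 (D : Type) (T : op_semigroup D) (S : tspace T) (B : set D) :
    set (set (set (taut S))) :=
  [set O | is_topology O /\ top4 S B `<=` O].

Arguments Q4 {D T} S B.

(* The empty union is allowed: an intersection involving it is empty, hence
   never a subgroup. *)
Definition finite_unions (X : Type) (L : set (set X)) : set (set X) :=
  [set \bigcup_(H in F) H | F in [set F | finite_set F /\ F `<=` L]].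

Definition nonempty_intersections (X : Type) (L : set (set X)) : set (set X) :=
  [set \bigcap_(H in F) H | F in [set F | F !=set0 /\ F `<=` L]].

(* Main.v *)
Require Import Defs.
From mathcomp Require Import all_boot.
From mathcomp Require Import boolp classical_sets.
From mathcomp Require Import finmap cardinality filter.

(** Write L for [GSGr S B].  Every member of L is a subgroup of [GGr S B], the
    largest member, and L is stable under nonempty intersections, because the
    automorphisms fixing each set of a family pointwise are those fixing the
    union of the family pointwise.

    A topology in [P4 S B] makes every member of L closed, so it contains the
    subbasis of [top4 S B] and hence [top4 S B] itself.  It also makes closed
    every nonempty intersection G of finite unions of members of L; such a G
    lies in [GGr S B], so if it is a subgroup then it belongs to L: (i) gives
    (ii).  Conversely the closed sets of [top4 S B] are exactly the possibly
    empty intersections of finite unions of members of L ([closed_generatedP]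
    is the inclusion that matters), and one contained in [GGr S B] is also a
    nonempty such intersection, since it does not change when [GGr S B] joins
    the family.  So (ii) says precisely that a closed subgroup of [GGr S B]
    belongs to L, which is (iii).  Finally (iii) exhibits a point of [P4 S B],
    which is (i).

    For the last claim, let a subgroup M be an intersection of finite unions of
    members of L, and let C(g) be the least member of L containing a given g in
    M.  Each of the finite unions has a term containing g, and that term
    contains C(g); hence C(g) lies in M.  So M is the union of the C(g), and
    being a subgroup it is their join, which belongs to L as soon as L is
    closed under joins ([join_closed_intersection_of_unions]). *)

Local Open Scope classical_set_scope.

Lemma finI_from_finite {X : Type} {P F : set (set X)} :
  finite_set F -> F `<=` P -> finI_from P id (\bigcap_(A in F) A).
Proof.
move=> /finite_fsetP[D ->] DP; exists D => // A AD; exact/mem_set/DP.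
Qed.

Lemma open_finI {X : Type} {O P : set (set X)} :
  is_topology O -> P `<=` O -> finI_from P id `<=` O.
Proof.
move=> [OT OI _] PO _ [D DP <-].
rewrite bigcap_fset big_seq; apply: big_ind => // A AD.
exact/PO/set_mem/DP.
Qed.

Lemma topology_generated_is_topology {X : Type} (P : set (set X)) :
  is_topology (topology_generated P).
Proof.
split.
- exists [set setT]; last by rewrite bigcup_set1.
  by move=> _ ->; rewrite -(bigcap_set0 id); exact: finI_from_finite.
- move=> _ _ [F FP <-] [F' FP' <-].
  exists [set A `&` A' | A in F & A' in F'].
    by move=> _ [A FA [A' FA' <-]]; apply: finI_fromI; [exact: FP|exact: FP'].
  apply/seteqP; split=> [x [_ [A FA [A' FA' <-]] [Ax A'x]]|].
    by split; [exists A|exists A'].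
  move=> x [[A FA Ax] [A' FA' A'x]].
  by exists (A `&` A') => //; exists A => //; exists A'.
- move=> F FP.
  (* A decomposition of the union that avoids choosing one for each member of
     the family: all the basic open sets contained in some member. *)
  exists [set A | finI_from P id A /\ exists2 U, F U & A `<=` U].
    by move=> A [].
  apply/seteqP; split=> [x [A [_ [U FU AU]] Ax]|x [U FU Ux]].
    by exists U => //; exact: AU.
  have [V VP VU] := FP _ FU; move: Ux; rewrite -VU => -[A VA Ax].
  exists A => //; split; first exact: VP.
  by exists U => //; rewrite -VU => y Ay; exists A.
Qed.

Lemma sub_topology_generated {X : Type} (P : set (set X)) :
  P `<=` topology_generated P.
Proof.
move=> A PA; exists [set A]; last by rewrite bigcup_set1.
by move=> _ ->; exact: (finI_from1 id).
Qed.

Lemma topology_generated_min {X : Type} {O P : set (set X)} :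
  is_topology O -> P `<=` O -> topology_generated P `<=` O.
Proof.
move=> tO PO _ [F FP <-]; have [_ _ OU] := tO.
by apply: OU => A /FP; exact: open_finI.
Qed.

Lemma closed_bigcap {X : Type} {O F : set (set X)} :
  is_topology O -> F `<=` closed_in O -> closed_in O (\bigcap_(H in F) H).
Proof.
move=> [_ _ OU] FO; rewrite /closed_in setC_bigcap -(bigcup_image F setC id).
by apply: OU => _ [H FH <-]; exact: FO.
Qed.

Lemma closed_finite_unions {X : Type} {O L : set (set X)} :
  is_topology O -> L `<=` closed_in O -> finite_unions L `<=` closed_in O.
Proof.
move=> tO LO _ [F [Ffin FL] <-].
rewrite /closed_in setC_bigcup -(bigcap_image F setC id).
apply: (open_finI tO (@subset_refl _ O)); apply: finI_from_finite.
  exact: finite_image.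
by move=> _ [H FH <-]; exact/LO/FL.
Qed.

(** The complement of a basic open set is a finite union of members of [L]; the
    whole space, when it occurs among the intersected sets, contributes nothing
    to that union and is discarded. *)
Lemma closed_generatedP {X : Type} {L : set (set X)} {M : set X} :
  closed_in (topology_generated ([set ~` H | H in L] `|` [set setT])) M ->
  exists2 F, F `<=` finite_unions L & M = \bigcap_(U in F) U.
Proof.
move=> [F FP FM]; exists [set ~` A | A in F]; last first.
  by rewrite bigcap_image -setC_bigcup FM setCK.
move=> _ [_ /FP[D DP <-] <-].
exists (L `&` [set ~` A | A in [set` D]]).
  split; last exact: subIsetl.
  apply: (@sub_finite_set _ _ [set ~` A | A in [set` D]]).
    exact: subIsetr.
  exact: finite_image.
rewrite setC_bigcap; apply/seteqP; split=> x.
  by move=> [H [LH [A DA <-]] Hx]; exists A.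
move=> [A DA nAx]; have [[H LH HA]|AT] := set_mem (DP _ DA).
  exists H; last by move: nAx; rewrite -HA => /contrapT.
  by split=> //; exists A => //; rewrite -HA setCK.
by case: nAx; rewrite AT.
Qed.

(** Each element [g] of [M] lies in some member of [L], since the family that
    defines [M] is nonempty, and so in a least one.  That least member is
    contained in [M], so [M] is a union of members of [L]; a subgroup that is
    the union of members of [L] is their join. *)
Lemma join_closed_intersection_of_unions {G : groupType} {L : set (set G)}
    {M : set G} :
  complete_join_sublattice L ->
  (forall F, F !=set0 -> F `<=` L -> L (\bigcap_(H in F) H)) ->
  nonempty_intersections (finite_unions L) M -> SGr G M -> L M.
Proof.
move=> [_ Ljoin] Lcap [E [[U0 EU0] EL] EM] MG.
have ME U : E U -> M `<=` U by move=> EU x; rewrite -EM; apply.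
have MU : \bigcup_(H in [set H | L H /\ H `<=` M]) H = M.
  apply/seteqP; split=> [x [H [_ HM] Hx]|g Mg]; first exact: HM.
  exists (\bigcap_(H in [set H | L H /\ H g]) H); last by move=> H [].
  split.
    apply: Lcap => [|H []//].
    have [A [_ AL] AU0] := EL _ EU0; move: (ME _ EU0 _ Mg).
    by rewrite -AU0 => -[H AH Hg]; exists H; split=> //; exact: AL.
  (* In each finite union, a term that contains [g] contains the least member of
     [L] containing [g]. *)
  move=> x Cx; rewrite -EM => U EU; have [A [_ AL] AU] := EL _ EU.
  move: (ME _ EU _ Mg); rewrite -AU => -[H AH Hg]; exists H => //.
  by apply: Cx; split=> //; exact: AL.
suff <- : smallest (SGr G) (\bigcup_(H in [set H | L H /\ H `<=` M]) H) = M.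
  by apply: Ljoin => H [].
by rewrite MU; exact: smallest_id.
Qed.

Lemma GGr_SGr {D : Type} {T : op_semigroup D} (S : tspace T) (K : set D) :
  SGr (taut S) (GGr S K).
Proof.
split; first exact: mem_set.
move=> s t /set_mem Ks /set_mem Kt; apply: mem_set => b Kb.
have tVb : taut_inv t b = b by rewrite -{1}(Kt b Kb); exact: (taut_invK t).1.
by change (s (taut_inv t b) = b); rewrite tVb; exact: Ks.
Qed.

Lemma GGr_antimono {D : Type} {T : op_semigroup D} (S : tspace T) (K K' : set D) :
  K `<=` K' -> GGr S K' `<=` GGr S K.
Proof. by move=> KK' s K's b Kb; exact/K's/KK'. Qed.

(** Fixing each set of a family pointwise is fixing its union pointwise; the
    union contains [B] because the family is nonempty. *)
Lemma GSGr_bigcap {D : Type} {T : op_semigroup D} {S : tspace T} {B : set D}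
    (F : set (set (taut S))) :
  F !=set0 -> F `<=` GSGr S B -> GSGr S B (\bigcap_(H in F) H).
Proof.
move=> [H0 FH0] FL.
pose A := [set K : set D | (B `<=` K /\ K `<=` S) /\ F (GGr S K)].
exists (\bigcup_(K in A) K).
  split; last by move=> x [K [[_ KS] _] Kx]; exact: KS.
  have [K0 [BK0 K0S] K0H0] := FL _ FH0; move=> x Bx; exists K0; last exact: BK0.
  by split=> //; rewrite K0H0.
apply/seteqP; split=> s.
  move=> As H FH; have [K BKS KH] := FL _ FH; rewrite -KH => b Kb.
  by apply: As; exists K => //; split=> //; rewrite KH.
by move=> Fs b [K [_ FK] Kb]; exact: Fs FK b Kb.
Qed.

Theorem theorem5p4p2 (D : Type) (T : op_semigroup D) (S : tspace T) (B : set D)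
    (hB : B `<=` tcarrier S) :
  let stmt_i := P4 S B !=set0 in
  let stmt_ii := forall G : set (taut S),
    nonempty_intersections (finite_unions (GSGr S B)) G ->
    SGr (taut S) G -> GSGr S B G in
  let stmt_iii := P4 S B (top4 S B) in
  let coarsest := P4 S B (top4 S B) /\ (forall O, P4 S B O -> top4 S B `<=` O) in
  [/\ P4 S B `<=` Q4 S B,
      (stmt_i <-> stmt_ii) /\ (stmt_ii <-> stmt_iii),
      stmt_iii <-> coarsest &
      complete_join_sublattice (GSGr S B) -> [/\ stmt_i, stmt_ii & stmt_iii]].
Proof.
move=> si sii siii coarsest.
have GBin : GSGr S B (GGr S B) by exists B => //; split.
have GSGr_sub H : GSGr S B H -> SGr (taut S) H /\ H `<=` GGr S B.
  by move=> [K [BK _] <-]; split; [exact: GGr_SGr|exact: GGr_antimono].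
have P4_closed O : P4 S B O -> GSGr S B `<=` closed_in O.
  by move=> [_ ->] H [].
have P4_sub O : P4 S B O -> top4 S B `<=` O.
  move=> OP; apply: topology_generated_min; first exact: OP.1.
  move=> _ [[H LH <-]|->]; first exact: P4_closed LH.
  by have [[]] := OP.
have i_ii : si -> sii.
  move=> [O OP] M [E [[U0 EU0] EL] <-] MG.
  have tO : is_topology O by case: OP.
  rewrite OP.2; split=> //.
    move=> s /(_ _ EU0); have [A [_ AL] <-] := EL _ EU0.
    by move=> [H AH Hs]; exact: (GSGr_sub _ (AL _ AH)).2.
  apply: closed_bigcap => // U /EL.
  exact: (closed_finite_unions tO (P4_closed _ OP)).
have ii_iii : sii -> siii.
  move=> ii; split; first exact: topology_generated_is_topology.
  apply/seteqP; split=> [H LH|M [MG MB /closed_generatedP[F FL MF]]].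
    have [HG HB] := GSGr_sub _ LH; split=> //.
    by apply: sub_topology_generated; left; exists H.
  apply: ii => //.
  (* [F] may be empty; adjoining [GGr S B], which contains [M], makes the family
     nonempty without changing its intersection. *)
  exists (GGr S B |` F).
    split; first by exists (GGr S B); left.
    move=> U [->|]; last exact: FL.
    exists [set GGr S B]; last by rewrite bigcup_set1.
    by split; [exact: finite_set1|move=> _ ->].
  by rewrite bigcap_setU1 -MF; exact/setIidPr.
have iii_i : siii -> si by exists (top4 S B).
split.
- by move=> O OP; split; [exact: OP.1|exact: P4_sub].
- by split; split=> // h; [exact/iii_i/ii_iii|exact/i_ii/iii_i].
- by split=> [h|[]].
- move=> joinL.
  have ii : sii.
    by move=> M; apply: join_closed_intersection_of_unions => // F; exact: GSGr_bigcap.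
  by split=> //; [exact/iii_i/ii_iii|exact: ii_iii].
Qed.
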